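(* Let $\mathbf P=(P,\leq,{}',0,1)$ be an orthoposet, $a,b\in P$ and $(B,\leq,{}',0,1)$ a Boolean subposet of $\mathbf P$. Then the following hold: (i) if $(\{a,b,b'\},\leq)$ is a distributive subposet of $\mathbf P$ then $a\mathrel\Delta b$; (ii) $x\mathrel\Delta y$ for all $x,y\in B$; (iii) $B$ is contained in some $\Delta$-block of $\mathbf P$.
   Context: An orthoposet is a tuple $(P,\leq,{}',0,1)$ where $(P,\leq,0,1)$ is a bounded poset and ${}'$ is a unary operation on $P$ such that $x\leq y$ implies $y'\leq x'$, $x''=x$, and for every $x$ the supremum $x\vee x'$ exists and equals $1$ and the infimum $x\wedge x'$ exists and equals $0$. For $A\subseteq P$ let $L(A)$ and $U(A)$ be the sets of all lower bounds and of all upper bounds of $A$ in $P$; several arguments (elements or subsets) denote the bounds of the union, e.g. $L(a,b)=L(\{a,b\})$, $U(A,B)=U(A\cup B)$, $LU(A)=L(U(A))$. For $a,b\in P$, $a\mathrel\Delta b$ means $U(a)=U(L(a,b),L(a,b'))$. A $\Delta$-block of $\mathbf P$ is a subset $B\subseteq P$ such that $x'\in B$ and $x\mathrel\Delta y$ for all $x,y\in B$, and which is maximal (with respect to inclusion) among subsets with this property. A subset $S\subseteq P$ is a distributive subposet of $\mathbf P$ if $L(U(x,y),z)=LU(L(x,z),L(y,z))$ for all $x,y,z\in S$, where $L$ and $U$ are computed in $\mathbf P$. A Boolean subposet of $\mathbf P$ is a distributive subposet $B$ of $\mathbf P$ that contains $0,1$ and is closed under ${}'$. *)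

(* Defs.v *)
From HB Require Import structures.
From mathcomp Require Import all_boot all_order.
From mathcomp Require Import boolp classical_sets.

Set Implicit Arguments.
Unset Strict Implicit.
Unset Printing Implicit Defensive.

Import Order.Theory.
Local Open Scope classical_set_scope.
Local Open Scope order_scope.

(* No distributivity is required, hence this is unrelated to [Order.compl]. *)
HB.mixin Record hasOrthocomplement (d : Order.disp_t) T
    & Order.TBPOrder d T := {
  ortho : T -> T;
  ortho_anti : forall x y : T, x <= y -> ortho y <= ortho x;
  orthoK : forall x : T, ortho (ortho x) = x;
  ortho_sup : forall x : T, supremums [set x; ortho x] \top;
  ortho_inf : forall x : T, infimums [set x; ortho x] \bot
}.

#[short(type="orthoposetType")]
HB.structure Definition Orthoposet (d : Order.disp_t) :=
  { T of hasOrthocomplement d T & Order.TBPOrder d T }.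

Section Orthoposets.
Context {d : Order.disp_t} {P : orthoposetType d}.
Implicit Types (a b x y z : P) (B C S : set P).

Definition Delta a b : Prop :=
  ubound [set a] =
  ubound (lbound [set a; b] `|` lbound [set a; ortho b]).

Definition Delta_closed B : Prop :=
  (forall x, B x -> B (ortho x)) /\ (forall x y, B x -> B y -> Delta x y).

Definition Delta_block B : Prop :=
  Delta_closed B /\ (forall C, Delta_closed C -> B `<=` C -> C = B).

Definition distributive_subposet S : Prop :=
  forall x y z, S x -> S y -> S z ->
    lbound (ubound [set x; y] `|` [set z]) =
    lbound (ubound (lbound [set x; z] `|` lbound [set y; z])).

Definition boolean_subposet B : Prop :=
  [/\ distributive_subposet B, B \bot, B \top
    & forall x, B x -> B (ortho x)].

End Orthoposets.

(* Main.v *)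
Require Import Defs.
From mathcomp Require Import all_boot all_order.
From mathcomp Require Import boolp classical_sets.

Import Order.Theory.
Local Open Scope classical_set_scope.

(** As $b\vee b'=1$, distributivity for $b,b',a$ has left side $L(1,a)=L(a)$, so $a\in
    LU(L(a,b),L(a,b'))$: this is the nontrivial half of [Delta a b]. A Boolean subposet contains
    $b'$ along with $b$, so all its pairs are related; Zorn's lemma then enlarges it to a block. *)

Lemma distributive_Delta (d : Order.disp_t) (P : orthoposetType d)
    (S : set P) (a b : P) :
  distributive_subposet S -> S a -> S b -> S (ortho b) -> Delta a b.
Proof.
move=> distS Sa Sb Sb'; rewrite /Delta; apply/seteqP; split=> u /= ubu.
  have au : (a <= u)%O by exact: ubu.
  by move=> z [] lbz; apply: le_trans au; apply: lbz; left.
move=> _ ->; have := distS _ _ _ Sb Sb' Sa.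
rewrite [X in lbound X `|` _]setUC [X in _ `|` lbound X]setUC => distE.
(* The only upper bound of $b$ and $b'$ is the top, which lies above $a$. *)
have : lbound (ubound [set b; ortho b] `|` [set a]) a.
  move=> v [ubv|->//].
  apply: le_trans (lex1 a) _.
  exact: (ortho_sup b).2.
by rewrite distE; apply.
Qed.

Lemma boolean_Delta_closed (d : Order.disp_t) (P : orthoposetType d)
    (B : set P) :
  boolean_subposet B -> Delta_closed B.
Proof.
move=> [distB _ _ orthoB]; split=> // x y Bx By.
exact: (distributive_Delta _ _ _ _ _ distB Bx By (orthoB _ By)).
Qed.

(** Closedness constrains at most two elements at a time, and any two elements of the union of a
    chain lie in a common member; so closedness passes to such unions and Zorn's lemma applies. *)
Lemma Delta_closed_sub_block (d : Order.disp_t) (P : orthoposetType d)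
    (B : set P) :
  Delta_closed B -> exists C : set P, Delta_block C /\ B `<=` C.
Proof.
move=> closedB.
(* Adjoining [B] to every member makes the empty chain harmless. *)
have [|A [closedA maxA]] := @Zorn_bigcup P [set X | Delta_closed (B `|` X)].
  move=> F Fclosed totF; split=> [x [Bx|[X FX Xx]]|x y].
  - by left; exact: closedB.1.
  - have [] := (Fclosed _ FX).1 x (or_intror Xx); first by left.
    by right; exists X.
  - move=> [Bx|[X FX Xx]] [By|[Y FY Yy]].
    + exact: closedB.2.
    + by apply: (Fclosed _ FY).2; [left|right].
    + by apply: (Fclosed _ FX).2; [right|left].
    + have [XY|YX] := totF _ _ FX FY.
      * by apply: (Fclosed _ FY).2; right=> //; exact: XY.
      * by apply: (Fclosed _ FX).2; right=> //; exact: YX.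
exists (B `|` A); split; last exact: subsetUl.
split=> // D closedD sBAD; apply/seteqP; split=> // x Dx; right.
(* A point of [D] outside [A] makes [D] strictly larger than [A], while $B\cup D=D$ is closed,
   against the maximality of [A]. *)
apply: contrapT => nAx; apply: (maxA D).
  by split; [exact: subset_trans sBAD|move=> /(_ x Dx)].
by rewrite /= (setUidPr _ _).2//; exact: subset_trans sBAD.
Qed.

Theorem lemma6p8 (d : Order.disp_t) (P : orthoposetType d) (a b : P)
    (B : set P) (HB : boolean_subposet B) :
  [/\ distributive_subposet [set a; b; ortho b] -> Delta a b,
      (forall x y : P, B x -> B y -> Delta x y)
    & exists C : set P, Delta_block C /\ B `<=` C].
Proof.
have closedB := boolean_Delta_closed _ _ _ HB.
split; last exact: Delta_closed_sub_block.
- by move=> /distributive_Delta; apply; [left; left|left; right|right].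
- exact: closedB.2.
Qed.
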